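(* Let $(M,d)$ be a multiplicative metric space and let $T:M\to M$ be a continuous function such that for each pair of distinct points $x,y\in M$ at least one of the following conditions is satisfied: (I) $d(Tx,Ty)< d(x,y)$; (II) $d(Tx,Ty)< \big(d(x,Tx)\cdot d(y,Ty)\big)^{\frac12}$; (III) $d(Tx,Ty)< \big(d(x,Ty)\cdot d(y,Tx)\big)^{\frac12}$. If for some $x_0\in M$ the sequence $\{T^n(x_0)\}_{n=0}^{\infty}$ has a limit point $z$ in $M$, then $z$ is the unique fixed point of $T$.
   Context: A multiplicative metric on a nonempty set $X$ is a mapping $d:X\times X\to\mathbb{R}$ such that for all $x,y,z\in X$: $d(x,y)\ge 1$; $d(x,y)=1$ if and only if $x=y$; $d(x,y)=d(y,x)$; and $d(x,z)\le d(x,y)\cdot d(y,z)$. The pair $(X,d)$ is called a multiplicative metric space. A sequence $\{x_n\}$ in $X$ converges (multiplicatively) to $x\in X$ if for every $\epsilon>1$ there is a positive integer $n_0$ with $d(x_n,x)<\epsilon$ for all $n\ge n_0$. A point $z\in X$ is a limit point of the sequence $\{x_n\}$ if some subsequence of $\{x_n\}$ converges (multiplicatively) to $z$. A function $f:X\to X$ is (multiplicative) continuous if for every $a\in X$ and every $\epsilon>1$ there is $\delta>1$ such that $d(x,a)<\delta$ implies $d(f(x),f(a))<\epsilon$. $T^n$ denotes the $n$-fold composition of $T$ with itself ($T^0$ is the identity). *)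

(* Defs.v *)
From Stdlib Require Import Reals.

Set Implicit Arguments.
Open Scope R_scope.

Record mult_metric_space : Type := MultMetricSpace {
  carrier :> Type;
  mdist : carrier -> carrier -> R;
  carrier_nonempty : inhabited carrier;
  mdist_ge1 : forall x y, 1 <= mdist x y;
  mdist_eq1 : forall x y, mdist x y = 1 <-> x = y;
  mdist_sym : forall x y, mdist x y = mdist y x;
  mdist_triangle : forall x y z, mdist x z <= mdist x y * mdist y z
}.

Arguments mdist {_} _ _.

Definition mult_converges (X : mult_metric_space) (u : nat -> X) (x : X) : Prop :=
  forall eps : R, 1 < eps ->
    exists n0 : nat, (0 < n0)%nat /\
      forall n : nat, (n0 <= n)%nat -> mdist (u n) x < eps.

Definition limit_point (X : mult_metric_space) (u : nat -> X) (z : X) : Prop :=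
  exists phi : nat -> nat,
    (forall m n : nat, (m < n)%nat -> (phi m < phi n)%nat) /\
    mult_converges X (fun n => u (phi n)) z.

Definition mult_continuous (X : mult_metric_space) (f : X -> X) : Prop :=
  forall (a : X) (eps : R), 1 < eps ->
    exists delta : R, 1 < delta /\
      forall x : X, mdist x a < delta -> mdist (f x) (f a) < eps.

(* Main.v *)
(* Along the orbit, [d (T^n x0) (T^(n+1) x0)] is nonincreasing, and each of the
   three conditions makes [d y (T y)] drop strictly under [T] unless [y] is
   fixed.  By continuity, orbit points close to [z] have displacement close to
   [d z (T z)], and their successors close to [d (T z) (T (T z))].  The orbit
   returns close to [z] infinitely often, so by monotonicity these two numbers
   agree, which forces [T z = z]. *)
Require Import Defs.
From Stdlib Require Import Reals Lra Lia Classical.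
Open Scope R_scope.

Lemma lt_sqrt_sqr (b p : R) : 0 <= b -> b < sqrt p -> b * b < p.
Proof.
  intros Hb Hlt.
  assert (Hp : 0 <= p).
  { destruct (Rle_dec 0 p) as [Hp | Hp]; [exact Hp |].
    (* [sqrt] is 0 on negative numbers, so [p < 0] would give [b < 0]. *)
    rewrite sqrt_neg_0 in Hlt; lra. }
  rewrite <- (sqrt_sqrt p Hp).
  apply Rmult_le_0_lt_compat; assumption.
Qed.

Lemma mdist_refl (M : mult_metric_space) (x : M) : mdist x x = 1.
Proof. now apply mdist_eq1. Qed.

Definition weakly_contractive (M : mult_metric_space) (T : M -> M) : Prop :=
  forall x y : M, x <> y ->
    mdist (T x) (T y) < mdist x y \/
    mdist (T x) (T y) < sqrt (mdist x (T x) * mdist y (T y)) \/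
    mdist (T x) (T y) < sqrt (mdist x (T y) * mdist y (T x)).

(** Take the pair [x], [T x], with a = d(x, Tx) and b = d(Tx, TTx). Condition (II) gives b^2 < ab.
    Condition (III) gives b^2 < d(x, TTx), the other factor being d(Tx, Tx) = 1, and the triangle
    inequality bounds this by ab. As b >= 1, either one yields b < a. *)
Lemma displacement_decr (M : mult_metric_space) (T : M -> M) (x : M) :
  weakly_contractive M T -> x <> T x -> mdist (T x) (T (T x)) < mdist x (T x).
Proof.
  intros HT Hx.
  pose proof (mdist_ge1 _ x (T x)) as Ha.
  pose proof (mdist_ge1 _ (T x) (T (T x))) as Hb.
  destruct (HT _ _ Hx) as [H | [H | H]]; [exact H | |];
    apply lt_sqrt_sqr in H; try lra.
  - nra.
  - rewrite mdist_refl in H.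
    pose proof (mdist_triangle _ x (T x) (T (T x))).
    nra.
Qed.

Lemma displacement_noninc (M : mult_metric_space) (T : M -> M) (x : M) :
  weakly_contractive M T -> mdist (T x) (T (T x)) <= mdist x (T x).
Proof.
  intros HT.
  destruct (classic (x = T x)) as [E | Hx].
  - rewrite <- E, <- E; apply Rle_refl.
  - now apply Rlt_le, displacement_decr.
Qed.

Lemma orbit_displacement_noninc (M : mult_metric_space) (T : M -> M)
  (x0 : M) (m n : nat) :
  weakly_contractive M T -> (m <= n)%nat ->
  mdist (Nat.iter n T x0) (T (Nat.iter n T x0)) <=
  mdist (Nat.iter m T x0) (T (Nat.iter m T x0)).
Proof.
  intros HT Hmn; induction Hmn as [| n _ IH]; [apply Rle_refl |].
  eapply Rle_trans; [exact (displacement_noninc M T _ HT) | exact IH].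
Qed.

(** At two distinct fixed points with d = d(x, y) >= 1, the conditions become d < d, d^2 < 1 and d^2
    < d^2, all absurd. *)
Lemma weakly_contractive_fixed_unique (M : mult_metric_space) (T : M -> M)
  (x y : M) :
  weakly_contractive M T -> T x = x -> T y = y -> x = y.
Proof.
  intros HT Ex Ey; apply NNPP; intros Hxy.
  pose proof (mdist_ge1 _ x y) as Hd.
  destruct (HT _ _ Hxy) as [H | [H | H]]; rewrite Ex, Ey in H; [lra | |];
    apply lt_sqrt_sqr in H; try lra.
  - rewrite !mdist_refl in H; nra.
  - rewrite (mdist_sym _ y x) in H; lra.
Qed.

Lemma limit_point_frequently (M : mult_metric_space) (u : nat -> M) (z : M)
  (eps : R) (N : nat) :
  limit_point M u z -> 1 < eps ->
  exists k, (N <= k)%nat /\ mdist (u k) z < eps.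
Proof.
  intros (phi & Hphi & Hconv) Heps.
  assert (Hge : forall n, (n <= phi n)%nat).
  { induction n as [| n IH]; [lia |].
    specialize (Hphi n (S n) (Nat.lt_succ_diag_r n)); lia. }
  destruct (Hconv eps Heps) as (n0 & _ & Hn0).
  exists (phi (Nat.max N n0)); split.
  - specialize (Hge (Nat.max N n0)); lia.
  - apply Hn0; lia.
Qed.

(** Go from [x] to [y] through [x'] and [y']: each moved endpoint costs one factor [e]. *)
Lemma mdist_perturb (M : mult_metric_space) (e : R) (x x' y y' : M) :
  mdist x x' < e -> mdist y y' < e -> mdist x y < e * e * mdist x' y'.
Proof.
  intros Hx Hy.
  pose proof (mdist_triangle _ x x' y) as H1.
  pose proof (mdist_triangle _ x' y' y) as H2.
  rewrite (mdist_sym _ y' y) in H2.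
  pose proof (mdist_ge1 _ x x'). pose proof (mdist_ge1 _ y y').
  pose proof (mdist_ge1 _ x' y').
  assert (mdist x x' * mdist y y' < e * e) by
    (apply Rmult_le_0_lt_compat; lra).
  assert (mdist x x' * mdist x' y <= mdist x x' * (mdist x' y' * mdist y y'))
    by (apply Rmult_le_compat_l; lra).
  assert (mdist x x' * mdist y y' * mdist x' y' < e * e * mdist x' y')
    by (apply Rmult_lt_compat_r; lra).
  lra.
Qed.

(** The tolerance for [limit_point_fixed], where two uses of [mdist_perturb] cost four factors [e]
    in total. *)
Lemma exists_fourth_root_ratio (a b : R) :
  0 < b < a -> exists e, 1 < e /\ e * e * (e * e * b) = a.
Proof.
  intros Hab.
  assert (Hr : 1 < a / b).
  { apply Rmult_lt_reg_r with b; [lra |].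
    unfold Rdiv; rewrite Rmult_assoc, Rinv_l; lra. }
  assert (Hs : 1 < sqrt (a / b)).
  { rewrite <- sqrt_1; apply sqrt_lt_1; lra. }
  exists (sqrt (sqrt (a / b))); split.
  - rewrite <- sqrt_1; apply sqrt_lt_1; lra.
  - rewrite sqrt_sqrt by lra.
    rewrite <- Rmult_assoc, sqrt_sqrt by lra.
    field; lra.
Qed.

Lemma limit_point_fixed (M : mult_metric_space) (T : M -> M) (x0 z : M) :
  mult_continuous M T -> weakly_contractive M T ->
  limit_point M (fun n : nat => Nat.iter n T x0) z -> T z = z.
Proof.
  intros Hcont HT Hlim; apply NNPP; intros Hz.
  pose proof (mdist_ge1 _ (T z) (T (T z))) as Hb.
  pose proof (displacement_decr M T z HT (not_eq_sym Hz)) as Hdecr.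
  destruct (exists_fourth_root_ratio (mdist z (T z)) (mdist (T z) (T (T z))))
    as (e & He & Ee); [lra |].
  (* The radii are chosen backwards: [d2] controls [T (T y)], then [d1] brings [T y] within both
     [d2] and [e] of [T z]. *)
  destruct (Hcont (T z) e He) as (d2 & Hd2 & Hc2).
  assert (Hmin2 : 1 < Rmin d2 e) by now apply Rmin_glb_lt.
  destruct (Hcont z (Rmin d2 e) Hmin2) as (d1 & Hd1 & Hc1).
  assert (Hmin1 : 1 < Rmin d1 e) by now apply Rmin_glb_lt.
  destruct (limit_point_frequently _ _ _ _ 0 Hlim Hmin1) as (k & _ & Hk).
  (* Starting from [S k] makes monotonicity compare the displacement of [y'] with that of [T y], not
     of [y]. *)
  destruct (limit_point_frequently _ _ _ _ (S k) Hlim Hmin1)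
    as (k' & Hkk' & Hk').
  pose proof (orbit_displacement_noninc M T x0 _ _ HT Hkk') as Hmono.
  simpl in Hmono, Hk, Hk'.
  set (y := Nat.iter k T x0) in *.
  set (y' := Nat.iter k' T x0) in *.
  pose proof (Rmin_l d1 e); pose proof (Rmin_r d1 e).
  pose proof (Rmin_l d2 e); pose proof (Rmin_r d2 e).
  assert (HTy : mdist (T y) (T z) < Rmin d2 e) by (apply Hc1; lra).
  assert (HTy' : mdist (T y') (T z) < Rmin d2 e) by (apply Hc1; lra).
  assert (HTTy : mdist (T (T y)) (T (T z)) < e) by (apply Hc2; lra).
  assert (Hsucc : mdist (T y) (T (T y)) < e * e * mdist (T z) (T (T z)))
    by (apply mdist_perturb; lra).
  assert (Hback : mdist z (T z) < e * e * mdist y' (T y')).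
  { apply mdist_perturb; rewrite mdist_sym; lra. }
  assert (e * e * mdist y' (T y') <= e * e * (e * e * mdist (T z) (T (T z)))).
  { apply Rmult_le_compat_l; nra. }
  (* The chain d(z, Tz) < e^2 d(y', Ty') <= e^2 d(Ty, TTy) < e^4 d(Tz, TTz) = d(z, Tz) is
     contradictory. *)
  lra.
Qed.

Theorem theorem3p4 (M : mult_metric_space) (T : M -> M)
  (T_continuous : mult_continuous M T)
  (T_contractive : forall x y : M, x <> y ->
     mdist (T x) (T y) < mdist x y \/
     mdist (T x) (T y) < sqrt (mdist x (T x) * mdist y (T y)) \/
     mdist (T x) (T y) < sqrt (mdist x (T y) * mdist y (T x)))
  (x0 z : M)
  (z_limit : limit_point M (fun n : nat => Nat.iter n T x0) z) :
  unique (fun x : M => T x = x) z.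
Proof.
  assert (Hz : T z = z) by (eapply limit_point_fixed; eassumption).
  split; [exact Hz |].
  intros w Hw; eapply weakly_contractive_fixed_unique; eassumption.
Qed.
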